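(* Let $(y(\cdot),z(\cdot))$ be a $C^4$ output curve on $(-\infty,+\infty)$ such that, with $a_d(t)=\big(\ddot y(t)^2+(g-\ddot z(t))^2\big)^{1/2}$, there are constants $a_{\min},a_{\max}$ with $0<a_{\min}\le a_d(t)\le a_{\max}$ for all $t$, and such that $\ddot\varphi_{qs}(\cdot)$ is bounded, where $\varphi_{qs}$ is the quasi-static roll angle of the curve. Then there exists $\epsilon_0>0$, namely $$\epsilon_0=\frac{1}{\left\|\ddot\varphi_{qs}(\cdot)/a_d(\cdot)\right\|_{L_\infty}},$$ such that for any $\epsilon\in(0,\epsilon_0)$: (i) there exists a bounded trajectory $\theta_\epsilon(\cdot)$ on $(-\infty,+\infty)$ of $$\epsilon\,\ddot\theta=a_d(t)\sin\theta-\epsilon\,\ddot\varphi_{qs}(t),$$ so that $\varphi_\epsilon(\cdot)=\varphi_{qs}(\cdot)+\theta_\epsilon(\cdot)$ is a bounded trajectory of the roll dynamics $$\epsilon\,\ddot\varphi=(g-\ddot z(t))\sin\varphi-\ddot y(t)\cos\varphi$$ whenever $\varphi_{qs}(\cdot)$ is bounded; and (ii) $\displaystyle\|\varphi_\epsilon(\cdot)-\varphi_{qs}(\cdot)\|_{L_\infty}\le\sin^{-1}\frac{\epsilon}{\epsilon_0}.$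
   Context: $g>0$ is the gravity constant. $\epsilon>0$ is the coupling parameter of the PVTOL aircraft model $\ddot y=u_1\sin\varphi-\epsilon u_2\cos\varphi$, $\ddot z=-u_1\cos\varphi-\epsilon u_2\sin\varphi+g$, $\ddot\varphi=u_2$; the roll dynamics in the claim is what $\varphi$ satisfies along a trajectory with prescribed output $(y(\cdot),z(\cdot))$. The quasi-static roll angle $\varphi_{qs}(t)$ is given by $\tan\varphi_{qs}(t)=\ddot y(t)/(g-\ddot z(t))$; more precisely it is the (continuous) angle of the vector $(\ddot y(t),g-\ddot z(t))$ satisfying $\ddot y(t)=a_d(t)\sin\varphi_{qs}(t)$ and $g-\ddot z(t)=a_d(t)\cos\varphi_{qs}(t)$. $\|\cdot\|_{L_\infty}$ is the supremum norm over $t\in(-\infty,+\infty)$. If $\ddot\varphi_{qs}\equiv0$, then $\epsilon_0$ is read as $+\infty$ (and $\epsilon/\epsilon_0$ as $0$). *)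

(* Defs.v *)
(* Stdlib real numbers with Coquelicot. *)
From Stdlib Require Import Reals.
From Coquelicot Require Import Coquelicot.
Open Scope R_scope.

(* [ex_derive_n f k t] alone only says that the total function
   [Derive_n f (k - 1)] is differentiable at [t]; hence all orders [k <= n]. *)
Definition n_times_differentiable (n : nat) (f : R -> R) : Prop :=
  forall (k : nat) (t : R), (k <= n)%nat -> ex_derive_n f k t.

Definition class_C (n : nat) (f : R -> R) : Prop :=
  n_times_differentiable n f /\ forall t : R, continuous (Derive_n f n) t.

Definition bounded_fun (f : R -> R) : Prop :=
  exists M : R, forall t : R, Rabs (f t) <= M.

Definition sup_norm (f : R -> R) : Rbar :=
  Lub_Rbar (fun r : R => exists t : R, r = Rabs (f t)).

Definition a_d (g : R) (y z : R -> R) (t : R) : R :=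
  sqrt ((Derive_n y 2 t) ^ 2 + (g - Derive_n z 2 t) ^ 2).

(* Determined by the output curve up to a constant multiple of [2 * PI]. *)
Definition quasi_static_roll (g : R) (y z phi_qs : R -> R) : Prop :=
  (forall t : R, continuous phi_qs t) /\
  (forall t : R, Derive_n y 2 t = a_d g y z t * sin (phi_qs t)) /\
  (forall t : R, g - Derive_n z 2 t = a_d g y z t * cos (phi_qs t)).

(* The zero case is separate because [Rbar_inv 0] is not [p_infty]. *)
Definition epsilon0 (g : R) (y z phi_qs : R -> R) : Rbar :=
  let N := sup_norm (fun t => Derive_n phi_qs 2 t / a_d g y z t) in
  if Rbar_eq_dec N 0 then p_infty else Rbar_div 1 N.

(* Solutions on the whole line of [eps * x'' = F t x]. *)
Definition trajectory (eps : R) (F : R -> R -> R) (x : R -> R) : Prop :=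
  n_times_differentiable 2 x /\
  forall t : R, eps * Derive_n x 2 t = F t (x t).

Definition error_dynamics (g : R) (y z phi_qs : R -> R) (eps : R)
    (t theta : R) : R :=
  a_d g y z t * sin theta - eps * Derive_n phi_qs 2 t.

Definition roll_dynamics (g : R) (y z : R -> R) (t phi : R) : R :=
  (g - Derive_n z 2 t) * sin phi - Derive_n y 2 t * cos phi.

(* Main.v *)
Require Import Defs.
From Stdlib Require Import Reals Lra Lia.
From Coquelicot Require Import Coquelicot.
Open Scope R_scope.

(** Put [p = a_d / eps], [h = Derive_n phi_qs 2] and
    [alpha = asin (eps / eps0)], so that the error dynamics reads
    [theta'' = p sin theta - h] and the definition of [eps0] gives
    [|h| <= p sin alpha], with [0 <= alpha < PI / 2].

    Along [|theta| <= alpha] the restoring coefficient [p cos theta] is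
    positive: the equation is of saddle type there, and a bounded solution on
    the whole line is found by a contraction rather than from initial values.
    Choose [k] with [k^2 >= p] and rewrite the equation as
    [k^2 theta - theta'' = N(theta)], where
    [N(theta) = k^2 theta - p sin theta + h].  The operator [k^2 - d^2/dt^2]
    has a bounded inverse on bounded continuous functions, convolution with
    [exp (- k |t|) / (2 k)] ([green] below), of norm [1 / k^2]
    ([green_bound]).  On [[-alpha, alpha]] the function
    [x => k^2 x - p sin x] is nondecreasing, with slope at most
    [k^2 - m cos alpha] when [p >= m > 0]
    ([restoring_remainder_increment]).  Two things follow.
    - Monotonicity gives [N(theta) <= k^2 alpha - p sin alpha + h <= k^2 alpha]
      and the symmetric lower bound, so [theta => green k (N theta)] maps
      [|theta| <= alpha] into itself.
    - The slope bound makes that map a contraction of ratio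
      [1 - m cos alpha / k^2 < 1].
    Its fixed point is the trajectory, and membership in the ball of radius
    [alpha] is the estimate of part (ii); see [bounded_solution_within].

    The other ingredient is regularity: [phi_qs] is only assumed continuous,
    but it is the polar angle of a nonvanishing [C^2] vector, hence is itself
    [C^2] ([is_derive_quasi_static_roll], [is_derive_roll_rate],
    [continuous_roll_acceleration]).  Finally, adding [phi_qs] turns the error
    dynamics into the roll dynamics by the addition formulas
    ([roll_dynamics_shift]). *)

(** * The bounded inverse of [k^2 - d^2/dt^2] *)

Lemma nondecreasing_of_derive (f df : R -> R) :
  (forall t, is_derive f t (df t)) -> (forall t, 0 <= df t) ->
  forall s t, s <= t -> f s <= f t.
Proof.
intros Hf Hpos s t Hst.
destruct (MVT_gen f s t df) as [c [_ Hc]].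
- intros x _; apply Hf.
- intros x _. apply continuity_pt_filterlim.
  apply (ex_derive_continuous f). now exists (df x).
- specialize (Hpos c). nra.
Qed.

Lemma is_lim_seq_exp_neg (k : R) :
  0 < k -> is_lim_seq (fun n => exp (k * - INR n)) 0.
Proof.
intros Hk.
apply is_lim_seq_ext with (fun n => exp (- k) ^ n).
- intros n. induction n as [|n IH].
  + simpl. rewrite <- exp_0. f_equal. ring.
  + rewrite <- tech_pow_Rmult, IH, S_INR, <- exp_plus. f_equal. ring.
- apply is_lim_seq_geom. rewrite Rabs_pos_eq by (left; apply exp_pos).
  rewrite <- exp_0. apply exp_increasing. lra.
Qed.

Definition weighted_primitive (k : R) (f : R -> R) (t : R) : R :=
  RInt (fun s => exp (k * s) * f s) 0 t.

Lemma continuous_exp_weight (k : R) (f : R -> R) :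
  (forall t, continuous f t) ->
  forall t, continuous (fun s => exp (k * s) * f s) t.
Proof.
intros Hf t. apply (continuous_mult (fun s => exp (k * s)) f); [|apply Hf].
apply (ex_derive_continuous (fun s : R => exp (k * s))). auto_derive. trivial.
Qed.

Lemma ex_RInt_exp_weight (k : R) (f : R -> R) (a b : R) :
  (forall t, continuous f t) -> ex_RInt (fun s => exp (k * s) * f s) a b.
Proof.
intros Hf. apply (ex_RInt_continuous (V := R_CompleteNormedModule)). intros x _.
now apply continuous_exp_weight.
Qed.

Lemma is_derive_weighted_primitive (k : R) (f : R -> R) (t : R) :
  (forall t, continuous f t) ->
  is_derive (weighted_primitive k f) t (exp (k * t) * f t).
Proof.
intros Hf.
apply (is_derive_RInt (fun s => exp (k * s) * f s) _ 0 t).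
- apply filter_forall. intros b. apply (RInt_correct (V := R_CompleteNormedModule)).
  now apply ex_RInt_exp_weight.
- now apply continuous_exp_weight.
Qed.

(** Since [|f| <= B], both [B exp (k t) / k + P] and [B exp (k t) / k - P] are
    nondecreasing in [t], where [P] is the weighted primitive.  This one
    estimate yields the limit of [P] at minus infinity and its rate. *)
Lemma weighted_primitive_increment (k B : R) (f : R -> R) :
  0 < k -> (forall t, continuous f t) -> (forall t, Rabs (f t) <= B) ->
  forall s t, s <= t ->
  Rabs (weighted_primitive k f t - weighted_primitive k f s) <=
  B / k * exp (k * t) - B / k * exp (k * s).
Proof.
intros Hk Hf HB s t Hst.
assert (Hexp : forall x, is_derive (fun x => B / k * exp (k * x)) x
                          (B * exp (k * x))).
{ intros x. auto_derive; trivial. field. lra. }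
assert (Hlow := nondecreasing_of_derive
  (fun x => B / k * exp (k * x) + weighted_primitive k f x)
  (fun x => B * exp (k * x) + exp (k * x) * f x)).
assert (Hupp := nondecreasing_of_derive
  (fun x => B / k * exp (k * x) - weighted_primitive k f x)
  (fun x => B * exp (k * x) - exp (k * x) * f x)).
assert (H1 : B / k * exp (k * s) + weighted_primitive k f s <=
             B / k * exp (k * t) + weighted_primitive k f t).
{ apply Hlow; trivial.
  - intros x. apply (is_derive_plus (V := R_NormedModule)); trivial.
    now apply is_derive_weighted_primitive.
  - intros x. generalize (HB x) (exp_pos (k * x)).
    intros Hx. apply Rabs_le_between in Hx. nra. }
assert (H2 : B / k * exp (k * s) - weighted_primitive k f s <=
             B / k * exp (k * t) - weighted_primitive k f t).
{ apply Hupp; trivial.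
  - intros x. apply (is_derive_minus (V := R_NormedModule)); trivial.
    now apply is_derive_weighted_primitive.
  - intros x. generalize (HB x) (exp_pos (k * x)).
    intros Hx. apply Rabs_le_between in Hx. nra. }
apply Rabs_le. lra.
Qed.

Definition primitive_at_minus_infty (k : R) (f : R -> R) : R :=
  real (Lim_seq (fun n => weighted_primitive k f (- INR n))).

Lemma is_lim_seq_weighted_primitive (k B : R) (f : R -> R) :
  0 < k -> (forall t, continuous f t) -> (forall t, Rabs (f t) <= B) ->
  is_lim_seq (fun n => weighted_primitive k f (- INR n))
             (primitive_at_minus_infty k f).
Proof.
intros Hk Hf HB. apply Lim_seq_correct'.
assert (Hinc := weighted_primitive_increment k B f Hk Hf HB).
assert (HBk : 0 <= B / k).
{ apply Rdiv_le_0_compat; trivial. generalize (Rabs_pos (f 0)) (HB 0). lra. }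
(* Adding the exponential bound on the tail turns the primitive into a
   monotone sequence. *)
assert (Hx : ex_finite_lim_seq (fun n =>
   weighted_primitive k f (- INR n) + B / k * exp (k * - INR n))).
{ apply ex_finite_lim_seq_decr
    with (weighted_primitive k f (- INR 0) - B / k * exp (k * - INR 0)).
  - intros n.
    assert (H : - INR (S n) <= - INR n) by (rewrite S_INR; lra).
    apply Hinc in H. apply Rabs_le_between in H. lra.
  - intros n.
    assert (H : - INR n <= - INR 0).
    { apply Ropp_le_contravar, le_INR. lia. }
    apply Hinc in H. apply Rabs_le_between in H.
    generalize (exp_pos (k * - INR n)). intros. nra. }
destruct Hx as [l Hl]. exists (l - B / k * 0).
apply is_lim_seq_ext with (fun n =>
  (weighted_primitive k f (- INR n) + B / k * exp (k * - INR n))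
  - B / k * exp (k * - INR n)); [intros; ring|].
apply is_lim_seq_minus'; trivial.
apply (is_lim_seq_scal_l _ (B / k) 0).
now apply is_lim_seq_exp_neg.
Qed.

(** The convolution of [f] with [exp (- k s)] over [s >= 0], written through a
    primitive from [0] so that no improper integral has to be
    differentiated. *)
Definition decaying_response (k : R) (f : R -> R) (t : R) : R :=
  exp (- k * t) * (weighted_primitive k f t - primitive_at_minus_infty k f).

Lemma is_derive_decaying_response (k : R) (f : R -> R) (t : R) :
  (forall t, continuous f t) ->
  is_derive (decaying_response k f) t (- k * decaying_response k f t + f t).
Proof.
intros Hf. unfold decaying_response.
assert (Hexp : exp (- k * t) * exp (k * t) = 1).
{ rewrite <- exp_plus, <- exp_0. f_equal. ring. }
replace (- k * _ + f t) with
  (- k * exp (- k * t)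
     * (weighted_primitive k f t - primitive_at_minus_infty k f)
   + exp (- k * t) * (exp (k * t) * f t - 0)).
2:{ rewrite Rminus_0_r, <- (Rmult_assoc _ _ (f t)), Hexp. ring. }
apply (is_derive_mult (fun x => exp (- k * x))
  (fun x => weighted_primitive k f x - primitive_at_minus_infty k f)).
- auto_derive; trivial. ring.
- apply (is_derive_minus (V := R_NormedModule) (weighted_primitive k f)).
  + now apply is_derive_weighted_primitive.
  + apply (is_derive_const (V := R_NormedModule)).
- exact Rmult_comm.
Qed.

Lemma decaying_response_bound (k B : R) (f : R -> R) (t : R) :
  0 < k -> (forall t, continuous f t) -> (forall t, Rabs (f t) <= B) ->
  Rabs (decaying_response k f t) <= B / k.
Proof.
intros Hk Hf HB.
assert (Hdiff : Rabs (weighted_primitive k f t - primitive_at_minus_infty k f)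
                <= B / k * exp (k * t)).
{ assert (Hlim : is_lim_seq
    (fun n => weighted_primitive k f t - weighted_primitive k f (- INR n))
    (weighted_primitive k f t - primitive_at_minus_infty k f)).
  { apply is_lim_seq_minus'; [apply is_lim_seq_const|].
    now apply is_lim_seq_weighted_primitive with B. }
  assert (Hrhs : is_lim_seq
    (fun n => B / k * exp (k * t) - B / k * exp (k * - INR n))
    (B / k * exp (k * t) - B / k * 0)).
  { apply is_lim_seq_minus'; [apply is_lim_seq_const|].
    apply (is_lim_seq_scal_l _ (B / k) 0). now apply is_lim_seq_exp_neg. }
  rewrite Rmult_0_r, Rminus_0_r in Hrhs.
  apply is_lim_seq_abs in Hlim.
  apply (is_lim_seq_le_loc _ _ _ _) with (2 := Hlim) (3 := Hrhs).
  destruct (INR_unbounded (- t)) as [n0 Hn0].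
  exists n0. intros n Hn. apply weighted_primitive_increment; trivial.
  apply le_INR in Hn. lra. }
unfold decaying_response.
rewrite Rabs_mult, (Rabs_pos_eq (exp _)) by (left; apply exp_pos).
replace (B / k) with (exp (- k * t) * (B / k * exp (k * t))).
- apply Rmult_le_compat_l; trivial. left; apply exp_pos.
- rewrite (Rmult_comm (B / k)), <- Rmult_assoc, <- exp_plus.
  replace (- k * t + k * t) with 0 by ring. rewrite exp_0. ring.
Qed.

Lemma decaying_response_minus (k B C : R) (f g : R -> R) (t : R) :
  0 < k ->
  (forall t, continuous f t) -> (forall t, Rabs (f t) <= B) ->
  (forall t, continuous g t) -> (forall t, Rabs (g t) <= C) ->
  decaying_response k (fun s => f s - g s) t =
  decaying_response k f t - decaying_response k g t.
Proof.
intros Hk Hf HB Hg HC.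
assert (HP : forall x, weighted_primitive k (fun s => f s - g s) x =
  weighted_primitive k f x - weighted_primitive k g x).
{ intros x. unfold weighted_primitive.
  rewrite <- (RInt_minus (V := R_CompleteNormedModule)
    (fun s => exp (k * s) * f s) (fun s => exp (k * s) * g s))
    by now apply ex_RInt_exp_weight.
  apply RInt_ext. intros s _. unfold minus, plus, opp; simpl. ring. }
assert (Hc : primitive_at_minus_infty k (fun s => f s - g s) =
  primitive_at_minus_infty k f - primitive_at_minus_infty k g).
{ unfold primitive_at_minus_infty at 1.
  rewrite (Lim_seq_ext _ (fun n => weighted_primitive k f (- INR n)
     - weighted_primitive k g (- INR n))) by (intros; apply HP).
  rewrite (is_lim_seq_unique _ (primitive_at_minus_infty k f
     - primitive_at_minus_infty k g)); trivial.
  apply is_lim_seq_minus'.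
  - now apply is_lim_seq_weighted_primitive with B.
  - now apply is_lim_seq_weighted_primitive with C. }
unfold decaying_response. rewrite HP, Hc. ring.
Qed.

Definition reversed (f : R -> R) (t : R) : R := f (- t).

Lemma continuous_reversed (f : R -> R) :
  (forall t, continuous f t) -> forall t, continuous (reversed f) t.
Proof.
intros Hf t. apply (continuous_comp (fun s : R => - s) f); [|apply Hf].
apply (continuous_opp (V := R_NormedModule) (fun s : R => s)).
apply continuous_id.
Qed.

(** Convolution of [f] with [exp (- k |t|) / (2 k)]: the first term is the
    contribution of the past of [t], the second, by time reversal, that of its
    future. *)
Definition green (k : R) (f : R -> R) (t : R) : R :=
  (decaying_response k f t + decaying_response k (reversed f) (- t)) / (2 * k).

(** The two halves of [green] satisfy [u' = - k u + f] and [v' = k v - f], so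
    the forcing cancels in the derivative of [u + v]. *)
Definition green_slope (k : R) (f : R -> R) (t : R) : R :=
  (decaying_response k (reversed f) (- t) - decaying_response k f t) / 2.

Lemma is_derive_reversed_response (k : R) (f : R -> R) (t : R) :
  (forall t, continuous f t) ->
  is_derive (fun s => decaying_response k (reversed f) (- s)) t
    (k * decaying_response k (reversed f) (- t) - f t).
Proof.
intros Hf.
replace (k * _ - f t) with
  (-1 * (- k * decaying_response k (reversed f) (- t) + reversed f (- t))).
- apply (is_derive_comp (V := R_NormedModule)
    (decaying_response k (reversed f)) (fun s : R => - s)).
  + apply is_derive_decaying_response. now apply continuous_reversed.
  + auto_derive; trivial.
- unfold reversed at 2. rewrite Ropp_involutive. ring.
Qed.

Lemma is_derive_green (k : R) (f : R -> R) (t : R) :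
  0 < k -> (forall t, continuous f t) ->
  is_derive (green k f) t (green_slope k f t).
Proof.
intros Hk Hf. unfold green.
apply is_derive_ext with (fun x => / (2 * k) * (decaying_response k f x
  + decaying_response k (reversed f) (- x))).
{ intros x. unfold Rdiv. apply Rmult_comm. }
replace (green_slope k f t) with (/ (2 * k) *
  ((- k * decaying_response k f t + f t) +
   (k * decaying_response k (reversed f) (- t) - f t)))
  by (unfold green_slope; field; lra).
apply is_derive_scal.
apply (is_derive_plus (V := R_NormedModule)).
- now apply is_derive_decaying_response.
- now apply is_derive_reversed_response.
Qed.

Lemma is_derive_green_slope (k : R) (f : R -> R) (t : R) :
  0 < k -> (forall t, continuous f t) ->
  is_derive (green_slope k f) t (k ^ 2 * green k f t - f t).
Proof.
intros Hk Hf. unfold green_slope.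
apply is_derive_ext with (fun x => / 2 *
  (decaying_response k (reversed f) (- x) - decaying_response k f x)).
{ intros x. unfold Rdiv. apply Rmult_comm. }
replace (k ^ 2 * green k f t - f t) with (/ 2 *
  ((k * decaying_response k (reversed f) (- t) - f t) -
   (- k * decaying_response k f t + f t)))
  by (unfold green; field; lra).
apply is_derive_scal.
apply (is_derive_minus (V := R_NormedModule)).
- now apply is_derive_reversed_response.
- now apply is_derive_decaying_response.
Qed.

Lemma continuous_green (k : R) (f : R -> R) (t : R) :
  0 < k -> (forall t, continuous f t) -> continuous (green k f) t.
Proof.
intros Hk Hf. apply (ex_derive_continuous (green k f)).
exists (green_slope k f t). now apply is_derive_green.
Qed.

(** The kernel is positive with integral [1 / k^2]. *)
Lemma green_bound (k B : R) (f : R -> R) (t : R) :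
  0 < k -> (forall t, continuous f t) -> (forall t, Rabs (f t) <= k ^ 2 * B) ->
  Rabs (green k f t) <= B.
Proof.
intros Hk Hf HB.
assert (H1 := decaying_response_bound k (k ^ 2 * B) f t Hk Hf HB).
assert (H2 := decaying_response_bound k (k ^ 2 * B) (reversed f) (- t) Hk
  (continuous_reversed f Hf) (fun s => HB (- s))).
replace (k ^ 2 * B / k) with (k * B) in H1, H2 by (field; lra).
unfold green, Rdiv.
rewrite Rabs_mult, (Rabs_pos_eq (/ _)) by (left; apply Rinv_0_lt_compat; lra).
apply Rle_trans with ((2 * k * B) * / (2 * k)).
- apply Rmult_le_compat_r; [left; apply Rinv_0_lt_compat; lra|].
  eapply Rle_trans; [apply Rabs_triang|]. lra.
- right. field. lra.
Qed.

Lemma green_minus (k B C : R) (f g : R -> R) (t : R) :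
  0 < k ->
  (forall t, continuous f t) -> (forall t, Rabs (f t) <= B) ->
  (forall t, continuous g t) -> (forall t, Rabs (g t) <= C) ->
  green k (fun s => f s - g s) t = green k f t - green k g t.
Proof.
intros Hk Hf HB Hg HC. unfold green.
change (reversed (fun s => f s - g s))
  with (fun s => reversed f s - reversed g s).
rewrite (decaying_response_minus k B C f g) by trivial.
rewrite (decaying_response_minus k B C (reversed f) (reversed g)).
- field. lra.
- trivial.
- now apply continuous_reversed.
- intros s; apply HB.
- now apply continuous_reversed.
- intros s; apply HC.
Qed.

(** * A contraction principle for bounded continuous functions *)

Definition continuous_bounded_by (a : R) (f : R -> R) : Prop :=
  (forall t, continuous f t) /\ forall t, Rabs (f t) <= a.

Lemma continuous_uniform_limit (u : nat -> R -> R) (x : R -> R)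
    (e : nat -> R) :
  (forall n t, continuous (u n) t) ->
  (forall n t, Rabs (x t - u n t) <= e n) ->
  is_lim_seq e 0 ->
  forall t, continuous x t.
Proof.
intros Hu He Hlim t.
apply (filterlim_locally (U := R_UniformSpace)). intros eps.
destruct (proj2 (is_lim_seq_spec e 0) Hlim (pos_div_2 (pos_div_2 eps)))
  as [n Hn].
specialize (Hn n (le_n n)). simpl in Hn. rewrite Rminus_0_r in Hn.
assert (Hc := proj1 (filterlim_locally (U := R_UniformSpace) _ _) (Hu n t)
  (pos_div_2 eps)).
revert Hc. apply filter_imp. intros s Hs.
change (Rabs (u n s - u n t) < eps / 2) in Hs.
change (Rabs (x s - x t) < eps).
generalize (He n s) (He n t). intros H1 H2.
apply Rabs_lt_between in Hn. apply Rabs_lt_between in Hs.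
apply Rabs_le_between in H1. apply Rabs_le_between in H2.
apply Rabs_lt_between. lra.
Qed.

Section FixedPoint.

Variables (a q : R) (T : (R -> R) -> R -> R).
Hypothesis Ha : 0 <= a.
Hypothesis Hq : 0 <= q < 1.
Hypothesis Hself : forall f, continuous_bounded_by a f -> continuous_bounded_by a (T f).
Hypothesis Hcontract : forall f h d,
  continuous_bounded_by a f -> continuous_bounded_by a h ->
  (forall t, Rabs (f t - h t) <= d) ->
  forall t, Rabs (T f t - T h t) <= q * d.

Let u (n : nat) : R -> R := Nat.iter n T (fun _ => 0).

Local Lemma iterate_within n : continuous_bounded_by a (u n).
Proof.
induction n as [|n IH].
- split; intros t; simpl.
  + apply continuous_const.
  + now rewrite Rabs_R0.
- now apply Hself.
Qed.

(** The crude bound [2 a] on the distance between two members of the ball,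
    contracted [n] times, avoids summing a geometric series. *)
Local Lemma iterate_cauchy n m t :
  Rabs (u (n + m) t - u n t) <= q ^ n * (2 * a).
Proof.
revert t. induction n as [|n IH]; intros t.
- rewrite Rmult_1_l. generalize (proj2 (iterate_within (0 + m)) t)
    (proj2 (iterate_within 0) t). intros H1 H2.
  apply Rabs_le_between in H1. apply Rabs_le_between in H2.
  apply Rabs_le. lra.
- rewrite <- tech_pow_Rmult, Rmult_assoc.
  apply (Hcontract (u (n + m)) (u n)); trivial; apply iterate_within.
Qed.

Local Lemma rate_lim : is_lim_seq (fun n => q ^ n * (2 * a)) 0.
Proof.
rewrite <- (Rmult_0_l (2 * a)).
apply (is_lim_seq_scal_r _ (2 * a) 0). apply is_lim_seq_geom.
rewrite Rabs_pos_eq; lra.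
Qed.

Lemma contraction_fixed_point :
  exists x, continuous_bounded_by a x /\ forall t, T x t = x t.
Proof.
assert (Hex : forall t, ex_finite_lim_seq (fun n => u n t)).
{ intros t. apply ex_lim_seq_cauchy_corr. intros eps.
  destruct (proj2 (is_lim_seq_spec _ 0) rate_lim (pos_div_2 eps)) as [N HN].
  exists N.
  assert (Htail : forall n, (N <= n)%nat -> Rabs (u n t - u N t) < eps / 2).
  { intros n Hn. replace n with (N + (n - N))%nat by lia.
    eapply Rle_lt_trans; [apply iterate_cauchy|].
    specialize (HN N (le_n N)). simpl in HN. rewrite Rminus_0_r in HN.
    eapply Rle_lt_trans; [apply Rle_abs | exact HN]. }
  intros n m Hn Hm. apply Htail in Hn. apply Htail in Hm.
  apply Rabs_lt_between in Hn. apply Rabs_lt_between in Hm.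
  apply Rabs_lt_between. lra. }
set (x := fun t => real (Lim_seq (fun n => u n t))).
assert (Hx : forall t, is_lim_seq (fun n => u n t) (x t)).
{ intros t. apply Lim_seq_correct', Hex. }
assert (Hrate : forall n t, Rabs (x t - u n t) <= q ^ n * (2 * a)).
{ intros n t.
  apply (is_lim_seq_le (fun m => Rabs (u (n + m)%nat t - u n t))
    (fun _ => q ^ n * (2 * a)) (Rabs (x t - u n t)) (q ^ n * (2 * a))).
  - intros m. apply iterate_cauchy.
  - apply (is_lim_seq_abs _ (x t - u n t)), is_lim_seq_minus'.
    + apply is_lim_seq_ext with (fun m => u (m + n)%nat t).
      { intros m. now rewrite Nat.add_comm. }
      now apply (is_lim_seq_incr_n (fun m => u m t)).
    + apply is_lim_seq_const.
  - apply is_lim_seq_const. }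
assert (Hin : continuous_bounded_by a x).
{ split.
  - apply continuous_uniform_limit with (2 := Hrate).
    + intros n t. apply iterate_within.
    + exact rate_lim.
  - intros t. apply (is_lim_seq_le (fun n => Rabs (u n t)) (fun _ => a)
      (Rabs (x t)) a).
    + intros n. apply iterate_within.
    + apply (is_lim_seq_abs _ (x t)), Hx.
    + apply is_lim_seq_const. }
exists x. split; trivial. intros t.
assert (Hz : Rabs (T x t - x t) <= 0).
{ apply (is_lim_seq_le (fun _ => Rabs (T x t - x t))
    (fun n => 2 * (q ^ n * (2 * a))) (Rabs (T x t - x t)) 0).
  - intros n.
    assert (H1 := Hcontract x (u n) _ Hin (iterate_within n) (Hrate n) t).
    change (T (u n) t) with (u (S n) t) in H1.
    assert (H2 := Hrate (S n) t).
    rewrite <- tech_pow_Rmult in H2.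
    assert (H3 : q * (q ^ n * (2 * a)) <= q ^ n * (2 * a)).
    { assert (0 <= q ^ n) by now apply pow_le.
      assert (0 <= q ^ n * (2 * a)) by (apply Rmult_le_pos; lra). nra. }
    apply Rabs_le_between in H1. apply Rabs_le_between in H2.
    apply Rabs_le. lra.
  - apply is_lim_seq_const.
  - replace (Finite 0) with (Rbar_mult 2 0) by (simpl; f_equal; ring).
    apply is_lim_seq_scal_l, rate_lim. }
assert (Hz' := Rabs_pos (T x t - x t)).
assert (Hz'' : Rabs (T x t - x t) = 0) by lra.
apply Rabs_eq_0 in Hz''. lra.
Qed.

End FixedPoint.

(** * Bounded solutions of [theta'' = p sin theta - h] *)

Lemma restoring_remainder_increment (K m p alpha x x' : R) :
  0 <= alpha < PI / 2 -> 0 <= m <= p -> p <= K ->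
  - alpha <= x -> x <= x' -> x' <= alpha ->
  0 <= (K * x' - p * sin x') - (K * x - p * sin x)
    <= (K - m * cos alpha) * (x' - x).
Proof.
intros Halpha Hm HK Hx Hxx' Hx'.
destruct (MVT_gen (fun s => K * s - p * sin s) x x' (fun s => K - p * cos s))
  as [c [Hc ->]].
- intros s _. auto_derive; trivial. ring.
- intros s _. apply continuity_pt_filterlim.
  apply (ex_derive_continuous (fun s : R => K * s - p * sin s)).
  auto_derive. trivial.
- rewrite Rmin_left, Rmax_right in Hc by trivial.
  assert (Hcos : 0 <= cos alpha <= cos c).
  { split; [apply cos_ge_0; lra|].
    destruct (Rle_lt_dec 0 c).
    - apply cos_decr_1; lra.
    - rewrite <- (cos_neg c). apply cos_decr_1; lra. }
  generalize (COS_bound c). intros Hb.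
  assert (m * cos alpha <= p * cos c) by nra.
  assert (p * cos c <= K) by nra.
  split.
  + apply Rmult_le_pos; lra.
  + apply Rmult_le_compat_r; lra.
Qed.

(** The constants [alpha] and [- alpha] are an upper and a lower solution
    because [|h| <= p sin alpha]; between them the map
    [theta => green k (k^2 theta - p sin theta + h)] is a contraction. *)
Theorem bounded_solution_within (p h : R -> R) (m M alpha : R) :
  (forall t, continuous p t) -> (forall t, continuous h t) ->
  0 < m -> (forall t, m <= p t <= M) ->
  0 <= alpha < PI / 2 ->
  (forall t, Rabs (h t) <= p t * sin alpha) ->
  exists theta theta',
    (forall t, is_derive theta t (theta' t)) /\
    (forall t, is_derive theta' t (p t * sin (theta t) - h t)) /\
    (forall t, Rabs (theta t) <= alpha).
Proof.
intros Hp Hh Hm HpM Halpha Hhp.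
(* Any [k] with [k ^ 2 >= M] serves; this one avoids a square root. *)
set (k := 1 + M).
assert (HM : m <= M) by (generalize (HpM 0); lra).
assert (Hk : 0 < k) by (unfold k; lra).
assert (HK : M <= k ^ 2) by (unfold k; nra).
assert (Hcos : 0 < cos alpha <= 1).
{ split; [apply cos_gt_0; lra | apply COS_bound]. }
set (N := fun (f : R -> R) t => k ^ 2 * f t - p t * sin (f t) + h t).
assert (HN : forall f, continuous_bounded_by alpha f ->
  continuous_bounded_by (k ^ 2 * alpha) (N f)).
{ intros f [Hf Hfa]. split; intros t.
  - apply (continuous_plus (V := R_NormedModule)); trivial.
    apply (continuous_minus (V := R_NormedModule)).
    + apply (continuous_scal_r (V := R_NormedModule) (k ^ 2)), Hf.
    + apply (continuous_mult p (fun t => sin (f t))); trivial.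
      now apply continuous_sin_comp.
  - specialize (Hfa t). apply Rabs_le_between in Hfa.
    specialize (Hhp t). apply Rabs_le_between in Hhp.
    specialize (HpM t).
    (* Compare the value at [f t] with those at [alpha] and [- alpha]. *)
    assert (H1 := restoring_remainder_increment (k ^ 2) m (p t) alpha
      (f t) alpha Halpha).
    assert (H2 := restoring_remainder_increment (k ^ 2) m (p t) alpha
      (- alpha) (f t) Halpha).
    rewrite sin_neg in H2. unfold N. apply Rabs_le. lra. }
set (q := 1 - m * cos alpha / k ^ 2).
assert (Hk2 : 0 < k ^ 2) by lra.
assert (Hq : 0 <= q < 1).
{ assert (0 < m * cos alpha / k ^ 2) by (apply Rdiv_lt_0_compat; nra).
  assert (m * cos alpha / k ^ 2 <= 1).
  { apply Rmult_le_reg_r with (k ^ 2); trivial.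
    unfold Rdiv. rewrite Rmult_assoc, Rinv_l by lra. nra. }
  unfold q. lra. }
assert (Hlip : forall f f' d,
  continuous_bounded_by alpha f -> continuous_bounded_by alpha f' ->
  (forall t, Rabs (f t - f' t) <= d) ->
  forall t, Rabs (N f t - N f' t) <= k ^ 2 * (q * d)).
{ intros f f' d [_ Hf] [_ Hf'] Hd t.
  specialize (Hf t). specialize (Hf' t). specialize (Hd t).
  apply Rabs_le_between in Hf. apply Rabs_le_between in Hf'.
  apply Rabs_le_between in Hd. specialize (HpM t).
  replace (k ^ 2 * (q * d)) with ((k ^ 2 - m * cos alpha) * d)
    by (unfold q; field; lra).
  assert (0 <= k ^ 2 - m * cos alpha) by nra.
  unfold N. apply Rabs_le.
  destruct (Rle_lt_dec (f t) (f' t)).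
  - assert (H1 := restoring_remainder_increment (k ^ 2) m (p t) alpha
      (f t) (f' t) Halpha).
    assert ((k ^ 2 - m * cos alpha) * (f' t - f t)
      <= (k ^ 2 - m * cos alpha) * d) by (apply Rmult_le_compat_l; lra).
    lra.
  - assert (H1 := restoring_remainder_increment (k ^ 2) m (p t) alpha
      (f' t) (f t) Halpha).
    assert ((k ^ 2 - m * cos alpha) * (f t - f' t)
      <= (k ^ 2 - m * cos alpha) * d) by (apply Rmult_le_compat_l; lra).
    lra. }
destruct (contraction_fixed_point alpha q (fun f => green k (N f)))
  as [theta [Hin Hfix]].
- lra.
- trivial.
- intros f Hf. destruct (HN f Hf) as [HNc HNb]. split; intros t.
  + now apply continuous_green.
  + now apply green_bound.
- intros f f' d Hf Hf' Hd t.
  destruct (HN f Hf) as [HNc HNb]. destruct (HN f' Hf') as [HNc' HNb'].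
  rewrite <- (green_minus k (k ^ 2 * alpha) (k ^ 2 * alpha)) by trivial.
  apply green_bound; trivial.
  + intros s. now apply (continuous_minus (V := R_NormedModule)).
  + now apply Hlip.
- destruct (HN theta Hin) as [HNc _].
  exists theta, (green_slope k (N theta)). split; [|split].
  + intros t. apply is_derive_ext with (green k (N theta)); trivial.
    now apply is_derive_green.
  + intros t. replace (p t * sin (theta t) - h t) with
      (k ^ 2 * green k (N theta) t - N theta t).
    * now apply is_derive_green_slope.
    * rewrite Hfix. unfold N. ring.
  + apply Hin.
Qed.

(** * Regularity of the quasi-static roll angle *)

(** Near [t] the continuous angle stays within [PI / 2] of its value at [t], so
    the difference is the arctangent of the tangent given by the cross and dot
    products of the vector [(v, u)] at the two times; this is differentiable
    even though no differentiability of the angle is assumed. *)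
Lemma is_derive_polar_angle (r angle u v : R -> R) (t u' v' : R) :
  (forall s, 0 < r s) ->
  (forall s, u s = r s * sin (angle s)) ->
  (forall s, v s = r s * cos (angle s)) ->
  continuous angle t ->
  is_derive u t u' -> is_derive v t v' ->
  is_derive angle t ((u' * v t - v' * u t) / (u t ^ 2 + v t ^ 2)).
Proof.
intros Hr Hu Hv Hc Hu' Hv'.
assert (Hnorm : 0 < u t * u t + v t * v t).
{ rewrite Hu, Hv. generalize (sin2_cos2 (angle t)) (Hr t). unfold Rsqr.
  intros H1 H2.
  replace (_ + _) with (r t * r t * (sin (angle t) * sin (angle t)
    + cos (angle t) * cos (angle t))) by ring.
  rewrite H1. nra. }
apply is_derive_ext_loc with (fun s => angle t
  + atan ((u s * v t - v s * u t) / (v s * v t + u s * u t))).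
- assert (Hpi : 0 < PI / 2) by (generalize PI_RGT_0; lra).
  assert (Hloc := proj1 (filterlim_locally (U := R_UniformSpace) _ _) Hc
    (mkposreal _ Hpi)).
  revert Hloc. apply filter_imp. intros s Hs.
  change (Rabs (angle s - angle t) < PI / 2) in Hs.
  apply Rabs_lt_between in Hs.
  assert (Hcos : 0 < cos (angle s - angle t)) by (apply cos_gt_0; lra).
  replace (_ / _) with (tan (angle s - angle t)).
  + rewrite atan_tan by lra. exact (Rplus_minus _ _).
  + replace (u s * v t - v s * u t) with (r s * r t * sin (angle s - angle t))
      by (rewrite sin_minus, !Hu, !Hv; ring).
    replace (v s * v t + u s * u t) with (r s * r t * cos (angle s - angle t))
      by (rewrite cos_minus, !Hu, !Hv; ring).
    unfold tan. field. generalize (Hr s) (Hr t). intros. repeat split; lra.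
- auto_derive.
  + repeat split; try (eexists; eassumption). lra.
  + rewrite (is_derive_unique _ _ _ Hu' : Derive (fun s => u s) t = u').
    rewrite (is_derive_unique _ _ _ Hv' : Derive (fun s => v s) t = v').
    replace (u t * v t - v t * u t) with 0 by ring.
    field. split; nra.
Qed.

Lemma trajectory_of_is_derive (eps : R) (F : R -> R -> R)
    (x x' x'' : R -> R) :
  (forall t, is_derive x t (x' t)) ->
  (forall t, is_derive x' t (x'' t)) ->
  (forall t, eps * x'' t = F t (x t)) ->
  trajectory eps F x.
Proof.
intros H1 H2 HF.
assert (HD1 : forall t, Derive x t = x' t)
  by (intros t; now apply is_derive_unique).
assert (HD2 : forall t, is_derive (Derive_n x 1) t (x'' t)).
{ intros t. apply is_derive_ext with x'; trivial. intros s. now rewrite <- HD1. }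
split.
- intros [|[|[|k]]] t Hk; simpl; trivial.
  + now exists (x' t).
  + exists (x'' t). apply HD2.
  + lia.
- intros t. rewrite <- HF. f_equal. now apply is_derive_unique.
Qed.

Lemma is_derive_Derive_n (n k : nat) (f : R -> R) (t : R) :
  n_times_differentiable n f -> (S k <= n)%nat ->
  is_derive (Derive_n f k) t (Derive_n f (S k) t).
Proof. intros Hf Hk. apply Derive_correct. exact (Hf (S k) t Hk). Qed.

Section RollAngle.

Variables (g : R) (y z phi_qs : R -> R).
Hypothesis Hy : class_C 4 y.
Hypothesis Hz : class_C 4 z.
Hypothesis Ha : forall t, 0 < a_d g y z t.
Hypothesis Hphi : quasi_static_roll g y z phi_qs.

Let A (t : R) : R := Derive_n y 2 t.
Let B (t : R) : R := g - Derive_n z 2 t.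

Local Lemma is_derive_A t : is_derive A t (Derive_n y 3 t).
Proof. apply (is_derive_Derive_n 4); [apply Hy | lia]. Qed.

Local Lemma is_derive_B t : is_derive B t (- Derive_n z 3 t).
Proof.
replace (- Derive_n z 3 t) with (0 - Derive_n z 3 t) by ring.
apply (is_derive_minus (V := R_NormedModule) (fun _ => g)).
- apply (is_derive_const (V := R_NormedModule)).
- apply (is_derive_Derive_n 4); [apply Hz | lia].
Qed.

Local Lemma squared_norm_pos t : 0 < A t ^ 2 + B t ^ 2.
Proof.
specialize (Ha t). unfold a_d in Ha.
apply Rnot_le_lt. intros H. apply sqrt_neg_0 in H. fold (A t) (B t) in Ha. lra.
Qed.

Lemma continuous_a_d t : continuous (a_d g y z) t.
Proof.
apply (continuous_sqrt_comp (fun s => A s ^ 2 + B s ^ 2)).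
apply (ex_derive_continuous (fun s => A s ^ 2 + B s ^ 2)).
auto_derive. repeat split; eexists; [apply is_derive_A | apply is_derive_B].
Qed.

(** The angular velocity of the vector [(B, A)]; the derivative of [B] is minus
    the third derivative of [z], whence the plus sign in the numerator. *)
Definition roll_rate (t : R) : R :=
  (Derive_n y 3 t * B t + Derive_n z 3 t * A t) / (A t ^ 2 + B t ^ 2).

Lemma is_derive_quasi_static_roll t : is_derive phi_qs t (roll_rate t).
Proof.
destruct Hphi as [Hc [Hs Hco]].
replace (roll_rate t) with
  ((Derive_n y 3 t * B t - - Derive_n z 3 t * A t) / (A t ^ 2 + B t ^ 2))
  by (unfold roll_rate; f_equal; ring).
apply is_derive_polar_angle with (a_d g y z); trivial.
- apply is_derive_A.
- apply is_derive_B.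
Qed.

(** An explicit formula for the derivative of [roll_rate]: its continuity uses
    the fourth derivatives of the output curve. *)
Definition roll_acceleration (t : R) : R :=
  ((Derive_n y 4 t * B t + Derive_n z 4 t * A t) * (A t ^ 2 + B t ^ 2)
   - (Derive_n y 3 t * B t + Derive_n z 3 t * A t)
     * (2 * A t * Derive_n y 3 t - 2 * B t * Derive_n z 3 t))
  / (A t ^ 2 + B t ^ 2) ^ 2.

Lemma is_derive_roll_rate t : is_derive roll_rate t (roll_acceleration t).
Proof.
assert (HA := is_derive_A t). assert (HB := is_derive_B t).
assert (Hy3 : is_derive (Derive_n y 3) t (Derive_n y 4 t))
  by (apply (is_derive_Derive_n 4); [apply Hy | lia]).
assert (Hz3 : is_derive (Derive_n z 3) t (Derive_n z 4 t))
  by (apply (is_derive_Derive_n 4); [apply Hz | lia]).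
assert (Hpos := squared_norm_pos t).
unfold roll_rate, roll_acceleration.
revert HA HB Hy3 Hz3 Hpos.
generalize (Derive_n y 3) (Derive_n z 3) (Derive_n y 4 t) (Derive_n z 4 t) A B.
intros y3 z3 y4 z4 A0 B0 HA HB Hy3 Hz3 Hpos.
auto_derive.
- repeat split; try (eexists; eassumption). simpl in Hpos; lra.
- rewrite (is_derive_unique _ _ _ HA : Derive (fun s => A0 s) t = y3 t).
  rewrite (is_derive_unique _ _ _ HB : Derive (fun s => B0 s) t = - z3 t).
  rewrite (is_derive_unique _ _ _ Hy3 : Derive (fun s => y3 s) t = y4).
  rewrite (is_derive_unique _ _ _ Hz3 : Derive (fun s => z3 s) t = z4).
  field. simpl in Hpos. lra.
Qed.

Lemma continuous_roll_acceleration t : continuous roll_acceleration t.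
Proof.
assert (HA : continuous A t).
{ apply (ex_derive_continuous A). eexists; apply is_derive_A. }
assert (HB : continuous B t).
{ apply (ex_derive_continuous B). eexists; apply is_derive_B. }
assert (Hy3 : continuous (Derive_n y 3) t).
{ apply (ex_derive_continuous (Derive_n y 3)).
  exact (proj1 Hy 4%nat t (le_n 4)). }
assert (Hz3 : continuous (Derive_n z 3) t).
{ apply (ex_derive_continuous (Derive_n z 3)).
  exact (proj1 Hz 4%nat t (le_n 4)). }
assert (Hy4 := proj2 Hy t). assert (Hz4 := proj2 Hz t).
assert (Hpos := squared_norm_pos t).
unfold roll_acceleration.
apply continuity_pt_filterlim in HA, HB, Hy3, Hz3, Hy4, Hz4.
apply continuity_pt_filterlim.
assert (Hmult : forall f1 f2, continuity_pt f1 t -> continuity_pt f2 t ->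
  continuity_pt (fun s => f1 s * f2 s) t)
  by (intros; now apply continuity_pt_mult).
assert (Hplus : forall f1 f2, continuity_pt f1 t -> continuity_pt f2 t ->
  continuity_pt (fun s => f1 s + f2 s) t)
  by (intros; now apply continuity_pt_plus).
assert (Hminus : forall f1 f2, continuity_pt f1 t -> continuity_pt f2 t ->
  continuity_pt (fun s => f1 s - f2 s) t)
  by (intros; now apply continuity_pt_minus).
assert (Hconst : forall c, continuity_pt (fun _ => c) t)
  by (intros c; apply continuity_pt_const; intros ? ?; reflexivity).
assert (Hdiv : forall f1 f2, continuity_pt f1 t -> continuity_pt f2 t ->
  f2 t <> 0 -> continuity_pt (fun s => f1 s / f2 s) t)
  by (intros; now apply continuity_pt_div).
assert (Hsqr : forall f1, continuity_pt f1 t ->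
  continuity_pt (fun s => f1 s ^ 2) t)
  by (intros; simpl; repeat apply Hmult; trivial).
apply Hdiv.
- repeat (assumption || apply Hconst || apply Hsqr || apply Hmult
    || apply Hminus || apply Hplus).
- repeat (assumption || apply Hsqr || apply Hplus).
- exact (pow_nonzero _ 2 (Rgt_not_eq _ _ Hpos)).
Qed.

End RollAngle.

(** * The coupling threshold and the main result *)

Lemma abs_le_sup_norm (f : R -> R) (t : R) : Rbar_le (Rabs (f t)) (sup_norm f).
Proof. apply (proj1 (Lub_Rbar_correct _)). now exists t. Qed.

Lemma sup_norm_le (f : R -> R) (b : R) :
  (forall t, Rabs (f t) <= b) -> Rbar_le (sup_norm f) b.
Proof.
intros Hf. apply (proj2 (Lub_Rbar_correct _)). intros r [t ->]. apply Hf.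
Qed.

Lemma sup_norm_finite (f : R -> R) :
  bounded_fun f ->
  exists N, sup_norm f = Finite N /\ 0 <= N /\ forall t, Rabs (f t) <= N.
Proof.
intros [b Hb].
assert (H0 := abs_le_sup_norm f). assert (H1 := sup_norm_le f b Hb).
destruct (sup_norm f) as [N | |]; simpl in H1.
- exists N. repeat split; trivial.
  generalize (H0 0) (Rabs_pos (f 0)). simpl. lra.
- contradiction.
- destruct (H0 0).
Qed.

(** Both branches of [epsilon0] give the ratio [eps / eps0] the same value
    [eps * N], which lets the proof treat [N = 0] without a case split. *)
Lemma epsilon0_spec (g : R) (y z phi_qs : R -> R) (N : R) :
  sup_norm (fun t => Derive_n phi_qs 2 t / a_d g y z t) = Finite N -> 0 <= N ->
  Rbar_lt 0 (epsilon0 g y z phi_qs) /\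
  forall eps, 0 < eps -> Rbar_lt eps (epsilon0 g y z phi_qs) ->
    real (Rbar_div eps (epsilon0 g y z phi_qs)) = eps * N /\ eps * N < 1.
Proof.
intros HN HN0. unfold epsilon0. rewrite HN.
destruct (Rbar_eq_dec N 0) as [H | H].
- injection H as ->. simpl. split; trivial. intros eps _ _. lra.
- assert (HNpos : 0 < N).
  { destruct HN0 as [|HN0]; trivial. subst N. now destruct H. }
  simpl. split.
  + rewrite Rmult_1_l. now apply Rinv_0_lt_compat.
  + rewrite Rmult_1_l. intros eps Heps Hlt. rewrite Rinv_inv. split; trivial.
    apply Rmult_lt_compat_r with (r := N) in Hlt; trivial.
    rewrite Rinv_l in Hlt; lra.
Qed.

(** In polar form the right-hand side of the roll dynamics is
    [a_d sin (phi - phi_qs)], so the quasi-static angle drops out. *)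
Lemma roll_dynamics_shift (g : R) (y z phi_qs : R -> R) (t x : R) :
  quasi_static_roll g y z phi_qs ->
  roll_dynamics g y z t (phi_qs t + x) = a_d g y z t * sin x.
Proof.
intros [_ [Hs Hc]]. unfold roll_dynamics. rewrite Hs, Hc, sin_plus, cos_plus.
generalize (sin2_cos2 (phi_qs t)). unfold Rsqr. intros H.
replace (a_d g y z t * sin x) with (a_d g y z t * sin x *
  (sin (phi_qs t) * sin (phi_qs t) + cos (phi_qs t) * cos (phi_qs t)))
  by (rewrite H; ring).
ring.
Qed.

(* [Rbar_div eps p_infty] is [0], so the bound below is [0] when [eps0] is
   [p_infty]. *)
Theorem theorem4p5 (g : R) (y z phi_qs : R -> R) (a_min a_max : R) :
  0 < g ->
  class_C 4 y ->
  class_C 4 z ->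
  0 < a_min ->
  (forall t : R, a_min <= a_d g y z t <= a_max) ->
  quasi_static_roll g y z phi_qs ->
  bounded_fun (Derive_n phi_qs 2) ->
  exists eps0 : Rbar,
    eps0 = epsilon0 g y z phi_qs /\
    Rbar_lt 0 eps0 /\
    forall eps : R, 0 < eps -> Rbar_lt eps eps0 ->
      exists theta : R -> R,
        let phi : R -> R := fun t => phi_qs t + theta t in
        bounded_fun theta /\
        trajectory eps (error_dynamics g y z phi_qs eps) theta /\
        trajectory eps (roll_dynamics g y z) phi /\
        (bounded_fun phi_qs -> bounded_fun phi) /\
        Rbar_le (sup_norm (fun t => phi t - phi_qs t))
                (asin (real (Rbar_div eps eps0))).
Proof.
intros _ Hy Hz Hamin Ha Hphi [b Hb].
assert (Hapos : forall t, 0 < a_d g y z t) by (intros t; specialize (Ha t); lra).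
assert (Hrate := is_derive_quasi_static_roll g y z phi_qs Hy Hz Hapos Hphi).
assert (Hacc := is_derive_roll_rate g y z Hy Hz Hapos).
set (h := roll_acceleration g y z) in *.
assert (Hh : forall t, Derive_n phi_qs 2 t = h t).
{ intros t. simpl. apply is_derive_unique.
  apply is_derive_ext with (roll_rate g y z); trivial.
  intros s. symmetry. now apply is_derive_unique. }
destruct (sup_norm_finite (fun t => Derive_n phi_qs 2 t / a_d g y z t))
  as [N [HN [HN0 HNle]]].
{ exists (b * / a_min). intros t. unfold Rdiv.
  rewrite Rabs_mult, (Rabs_pos_eq (/ _))
    by (left; now apply Rinv_0_lt_compat).
  apply Rmult_le_compat; trivial.
  - apply Rabs_pos.
  - left; now apply Rinv_0_lt_compat.
  - apply Rinv_le_contravar; [trivial | apply Ha]. }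
destruct (epsilon0_spec g y z phi_qs N HN HN0) as [Hpos Hsmall].
exists (epsilon0 g y z phi_qs). split; [reflexivity|]. split; [exact Hpos|].
intros eps Heps Hlt.
destruct (Hsmall eps Heps Hlt) as [-> HepsN].
assert (HepsN0 : 0 <= eps * N) by (apply Rmult_le_pos; lra).
set (alpha := asin (eps * N)).
assert (Halpha : 0 <= alpha < PI / 2).
{ split; [|apply asin_bound_lt; lra].
  apply Rnot_lt_le. intros Hneg.
  assert (Hsin : sin alpha = eps * N) by (apply sin_asin; lra).
  assert (Hge := proj1 (asin_bound (eps * N))). fold alpha in Hge.
  assert (0 < sin (- alpha)).
  { apply sin_gt_0; generalize PI_RGT_0; lra. }
  rewrite sin_neg in H. lra. }
destruct (bounded_solution_within (fun t => / eps * a_d g y z t) h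
  (/ eps * a_min) (/ eps * a_max) alpha)
  as [theta [theta' [Htheta [Htheta' Hbound]]]].
- intros t. apply (continuous_scal_r (V := R_NormedModule) (/ eps)).
  now apply continuous_a_d.
- now apply continuous_roll_acceleration.
- apply Rmult_lt_0_compat; trivial. now apply Rinv_0_lt_compat.
- intros t. assert (0 < / eps) by now apply Rinv_0_lt_compat.
  split; (apply Rmult_le_compat_l; [lra | apply Ha]).
- exact Halpha.
- intros t. unfold alpha. rewrite sin_asin by lra.
  replace (/ eps * a_d g y z t * (eps * N)) with (N * a_d g y z t)
    by (field; lra).
  specialize (HNle t). simpl in HNle. rewrite <- Hh.
  replace (Derive_n phi_qs 2 t)
    with (Derive_n phi_qs 2 t / a_d g y z t * a_d g y z t)
    by (field; apply Rgt_not_eq, Hapos).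
  rewrite Rabs_mult, (Rabs_pos_eq (a_d g y z t)) by (left; apply Hapos).
  apply Rmult_le_compat_r; trivial. left; apply Hapos.
- exists theta. intros phi. split; [|split; [|split; [|split]]].
  + now exists alpha.
  + apply (trajectory_of_is_derive _ _ _ _ _ Htheta Htheta').
    intros t. unfold error_dynamics. rewrite Hh. field. lra.
  + apply (trajectory_of_is_derive _ _ phi
      (fun t => roll_rate g y z t + theta' t)
      (fun t => h t + (/ eps * a_d g y z t * sin (theta t) - h t))).
    * intros t. now apply (is_derive_plus (V := R_NormedModule)).
    * intros t. now apply (is_derive_plus (V := R_NormedModule)).
    * intros t. unfold phi. rewrite roll_dynamics_shift by trivial. field. lra.
  + intros [c Hc]. exists (c + alpha). intros t. unfold phi.
    eapply Rle_trans; [apply Rabs_triang|]. now apply Rplus_le_compat.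
  + apply sup_norm_le. intros t. unfold phi.
    rewrite Rplus_minus_l.
    apply Hbound.
Qed.
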